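(* Let $\mathcal C$ be a biclosed $\mathcal V$-action (with $\mathcal V$ a monoidal category) and let $X\in\mathcal C$. (i) For every strong endofunctor $T=(T,\varphi)$ on $\mathcal C$, the $T$-algebra structures $s:TX\to X$ on $X$ are in bijective correspondence, via $s\mapsto\sigma(s)$, with the strong functor morphisms $T\to\mathrm C_X$. (ii) For every strong monad $\mathbb T=(T,\varphi,\eta,\mu)$ on $\mathcal C$, the $\mathbb T$-algebra (Eilenberg–Moore algebra) structures $s:TX\to X$ on $X$ are in bijective correspondence, via $s\mapsto\sigma(s)$, with the strong monad morphisms $\mathbb T\to\mathbb C_X$.
   Context: An object written in place of a morphism denotes its identity. **Actions.** Let $\mathcal V=(\mathcal V,I,\cdot,\alpha,\lambda,\rho)$ be a monoidal category. A $\mathcal V$-action is a category $\mathcal C$ with a functor $*:\mathcal V\times\mathcal C\to\mathcal C$ and natural isomorphisms $\underline\lambda_C:I*C\to C$, $\underline\alpha_{U,V,C}:(U\cdot V)*C\to U*(V*C)$ with $\underline\lambda_{V*C}\circ\underline\alpha_{I,V,C}=\lambda_V*C$, $(V*\underline\lambda_C)\circ\underline\alpha_{V,I,C}=\rho_V*C$ and $(U*\underline\alpha_{V,W,C})\circ\underline\alpha_{U,V\cdot W,C}\circ(\alpha_{U,V,W}*C)=\underline\alpha_{U,V,W*C}\circ\underline\alpha_{U\cdot V,W,C}$. It is biclosed if every functor $(-)*C:\mathcal V\to\mathcal C$ has a right adjoint $\underline{\mathcal C}(C,-)$, with counit $\underline\varepsilon^C_D:\underline{\mathcal C}(C,D)*C\to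 D$, and every functor $V*(-):\mathcal C\to\mathcal C$ has a right adjoint $[V,-]$, with counit $\varepsilon^V_D:V*[V,D]\to D$. ''Transpose'' refers to these adjunctions; $\underline{\mathcal C}(-,=)$ and $[-,=]$ are bifunctors, contravariant in the first argument. **Strong functors and monads.** A strong endofunctor $(F,\varphi)$ on $\mathcal C$ is an endofunctor $F$ with a natural transformation $\varphi_{V,C}:V*FC\to F(V*C)$ such that $F(\underline\lambda_C)\circ\varphi_{I,C}=\underline\lambda_{FC}$ and $\varphi_{U,V*C}\circ(U*\varphi_{V,C})\circ\underline\alpha_{U,V,FC}=F(\underline\alpha_{U,V,C})\circ\varphi_{U\cdot V,C}$. A strong functor morphism $\tau:(F,\varphi)\to(F',\varphi')$ is a natural transformation with $\varphi'_{V,C}\circ(V*\tau_C)=\tau_{V*C}\circ\varphi_{V,C}$. Composites carry the strength $G(\varphi)\circ\psi F$ on $GF$, for $(F,\varphi)$ and $(G,\psi)$. A strong monad $(T,\varphi,\eta,\mu)$ is a strong endofunctor $(T,\varphi)$ with a monad $(T,\eta,\mu)$ such that $\varphi_{V,C}\circ(V*\eta_C)=\eta_{V*C}$ and $\varphi_{V,C}\circ(V*\mu_C)=\mu_{V*C}\circ T(\varphi_{V,C})\circ\varphi_{V,TC}$. A strong monad morphism is a natural transformation that is both a strong functor morphism and a monad morphism ($\tau\circ\eta=\eta'$, $\tau_C\circ\mu_C=\mu'_C\circ(\tau\tau)_C$). A $T$-algebra structure on $X$, for an endofunctor $T$, is any morphism $TX\to X$. **The map $\sigma$ and the clone monad $\mathbb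 C_X$.** The endofunctor $\mathrm C_X=[\underline{\mathcal C}(-,X),X]$ carries the strength $\kappa^X_{V,A}:V*\mathrm C_XA\to\mathrm C_X(V*A)$ that is the transpose of $\varepsilon^{\underline{\mathcal C}(A,X)}_X\circ(\epsilon_{V,A}*\mathrm C_XA)\circ\underline\alpha^{-1}:\underline{\mathcal C}(V*A,X)*(V*\mathrm C_XA)\to X$, where $\epsilon_{V,A}:\underline{\mathcal C}(V*A,X)\cdot V\to\underline{\mathcal C}(A,X)$ is the transpose of $\underline\varepsilon^{V*A}_X\circ\underline\alpha:(\underline{\mathcal C}(V*A,X)\cdot V)*A\to X$. For a strong endofunctor $(F,\varphi)$ and $f:FX\to X$, let $\sigma(f)_A:FA\to[\underline{\mathcal C}(A,X),X]$ be the transpose of $f\circ F(\underline\varepsilon^A_X)\circ\varphi_{\underline{\mathcal C}(A,X),A}:\underline{\mathcal C}(A,X)*FA\to X$. Let $\nu:\mathrm C_XX\to X$ be the composite of $[\imath_X,X]:[\underline{\mathcal C}(X,X),X]\to[I,X]$, $\underline\lambda^{-1}:[I,X]\to I*[I,X]$ and $\varepsilon^I_X:I*[I,X]\to X$, with $\imath_X:I\to\underline{\mathcal C}(X,X)$ the transpose of $\underline\lambda_X$. The clone monad $\mathbb C_X$ is the strong monad with underlying strong endofunctor $(\mathrm C_X,\kappa^X)$, unit $\sigma(\mathrm{id}_X):\mathrm{Id}\to\mathrm C_X$ and multiplication $\sigma(\nu\circ\mathrm C_X\nu):\mathrm C_X\mathrm C_X\to\mathrm C_X$. *)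

(* Defs.v *)
From mathcomp Require Import ssreflect ssrfun ssrbool.

Set Implicit Arguments.
Unset Strict Implicit.
Unset Printing Implicit Defensive.

#[local] Obligation Tactic := idtac.

Declare Scope cat_scope.
Delimit Scope cat_scope with cat.
Local Open Scope cat_scope.

Reserved Notation "g ∘ f" (at level 40, left associativity).
Reserved Notation "U ⊗ V" (at level 35, right associativity).
Reserved Notation "u ⊗₁ v" (at level 35, right associativity).
Reserved Notation "V ⊛ A" (at level 35, right associativity).
Reserved Notation "v ⊛₁ f" (at level 35, right associativity).

Record category := Category {
  obj :> Type;
  hom : obj -> obj -> Type;
  idm : forall A, hom A A;
  compm : forall A B D, hom B D -> hom A B -> hom A D;
  compm1 : forall A B (f : hom A B), compm f (idm A) = f;
  comp1m : forall A B (f : hom A B), compm (idm B) f = f;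
  compmA : forall A B D E (h : hom D E) (g : hom B D) (f : hom A B),
    compm h (compm g f) = compm (compm h g) f
}.
Arguments hom {c} _ _.
Arguments idm {c} A.
Arguments compm {c A B D} _ _.
Notation "g ∘ f" := (compm g f) : cat_scope.

Record iso (C : category) (A B : C) := Iso {
  fwd :> hom A B;
  bwd : hom B A;
  fwdK : bwd ∘ fwd = idm A;
  bwdK : fwd ∘ bwd = idm B
}.

Record functor (C D : category) := Functor {
  fobj :> C -> D;
  fmap : forall A B, hom A B -> hom (fobj A) (fobj B);
  fmap1 : forall A, fmap (idm A) = idm (fobj A);
  fmapM : forall A B E (g : hom B E) (f : hom A B),
    fmap (g ∘ f) = fmap g ∘ fmap f
}.
Arguments fmap {C D} _ {A B} _.

Definition id_functor (C : category) : functor C C :=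
  @Functor C C (fun A => A) (fun _ _ f => f)
    (fun _ => erefl) (fun _ _ _ _ _ => erefl).

Program Definition comp_functor (C D E : category)
    (G : functor D E) (F : functor C D) : functor C E :=
  @Functor C E (fun A => G (F A)) (fun _ _ f => fmap G (fmap F f)) _ _.
Next Obligation. by move=> * /=; rewrite !fmap1. Qed.
Next Obligation. by move=> * /=; rewrite !fmapM. Qed.

Program Definition prod_cat (C D : category) : category :=
  @Category (C * D)%type
    (fun P Q => (hom P.1 Q.1 * hom P.2 Q.2)%type)
    (fun P => (idm P.1, idm P.2))
    (fun _ _ _ g f => (g.1 ∘ f.1, g.2 ∘ f.2)) _ _ _.
Next Obligation. by move=> C D A B [f g]; rewrite /= !compm1. Qed.
Next Obligation. by move=> C D A B [f g]; rewrite /= !comp1m. Qed.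
Next Obligation. by move=> C D *; rewrite /= !compmA. Qed.

(* A chosen right adjoint, given by its counit and the transposition of maps
   L A -> B; naturality of transposition follows. *)
Record right_adjoint (C D : category) (L : functor C D) := RightAdjoint {
  radj :> functor D C;
  counit : forall B, hom (L (radj B)) B;
  counit_nat : forall B B' (g : hom B B'),
    g ∘ counit B = counit B' ∘ fmap L (fmap radj g);
  transpose : forall A B, hom (L A) B -> hom A (radj B);
  transposeK : forall A B (f : hom (L A) B),
    counit B ∘ fmap L (transpose f) = f;
  transpose_uniq : forall A B (g : hom A (radj B)),
    transpose (counit B ∘ fmap L g) = g
}.
Arguments counit {C D L} _ B.
Arguments transpose {C D L} _ {A B} _.
Arguments transposeK {C D L} _ {A B} _.
Arguments transpose_uniq {C D L} _ {A B} _.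

Definition bimap (C D E : category) (F : functor (prod_cat C D) E)
    (A A' : C) (B B' : D) (f : hom A A') (g : hom B B') :
    hom (F (A, B)) (F (A', B')) :=
  @fmap _ _ F (A, B) (A', B') (f, g).

Record monoidal := Monoidal {
  mcat :> category;
  munit : mcat;
  mtens : functor (prod_cat mcat mcat) mcat;
  massoc : forall U V W : mcat,
    iso (mtens (mtens (U, V), W)) (mtens (U, mtens (V, W)));
  munitl : forall V : mcat, iso (mtens (munit, V)) V;
  munitr : forall V : mcat, iso (mtens (V, munit)) V;
  massoc_nat : forall (U U' V V' W W' : mcat)
      (u : hom U U') (v : hom V V') (w : hom W W'),
    massoc U' V' W' ∘ bimap mtens (bimap mtens u v) w
    = bimap mtens u (bimap mtens v w) ∘ massoc U V W;
  munitl_nat : forall (V V' : mcat) (v : hom V V'),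
    munitl V' ∘ bimap mtens (idm munit) v = v ∘ munitl V;
  munitr_nat : forall (V V' : mcat) (v : hom V V'),
    munitr V' ∘ bimap mtens v (idm munit) = v ∘ munitr V;
  mpentagon : forall U V W Z : mcat,
    bimap mtens (idm U) (massoc V W Z) ∘ massoc U (mtens (V, W)) Z
      ∘ bimap mtens (massoc U V W) (idm Z)
    = massoc U V (mtens (W, Z)) ∘ massoc (mtens (U, V)) W Z;
  mtriangle : forall U V : mcat,
    bimap mtens (idm U) (munitl V) ∘ massoc U munit V
    = bimap mtens (munitr U) (idm V)
}.
Arguments munit {m}.

Notation "U ⊗ V" := (fobj (mtens _) (U, V)) : cat_scope.
Notation "u ⊗₁ v" := (bimap (mtens _) u v) : cat_scope.

Record action (V : monoidal) := Action {
  acat :> category;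
  act : functor (prod_cat V acat) acat;
  aunit : forall C : acat, iso (act (munit, C)) C;
  aassoc : forall (U W : V) (C : acat),
    iso (act (U ⊗ W, C)) (act (U, act (W, C)));
  aunit_nat : forall (C C' : acat) (f : hom C C'),
    aunit C' ∘ bimap act (idm munit) f = f ∘ aunit C;
  aassoc_nat : forall (U U' W W' : V) (C C' : acat)
      (u : hom U U') (w : hom W W') (f : hom C C'),
    aassoc U' W' C' ∘ bimap act (u ⊗₁ w) f
    = bimap act u (bimap act w f) ∘ aassoc U W C;
  aunitl : forall (W : V) (C : acat),
    aunit (act (W, C)) ∘ aassoc munit W C = bimap act (munitl W) (idm C);
  aunitr : forall (W : V) (C : acat),
    bimap act (idm W) (aunit C) ∘ aassoc W munit C
    = bimap act (munitr W) (idm C);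
  apentagon : forall (U W Z : V) (C : acat),
    bimap act (idm U) (aassoc W Z C) ∘ aassoc U (W ⊗ Z) C
      ∘ bimap act (massoc U W Z) (idm C)
    = aassoc U W (act (Z, C)) ∘ aassoc (U ⊗ W) Z C
}.
Arguments act {V} _.

Notation "V ⊛ A" := (fobj (act _) (V, A)) : cat_scope.
Notation "v ⊛₁ f" := (bimap (act _) v f) : cat_scope.

Lemma bimapM (C D E : category) (F : functor (prod_cat C D) E)
    (A A' A'' : C) (B B' B'' : D) (f' : hom A' A'') (f : hom A A')
    (g' : hom B' B'') (g : hom B B') :
  bimap F (f' ∘ f) (g' ∘ g) = bimap F f' g' ∘ bimap F f g.
Proof. by rewrite /bimap -fmapM. Qed.

Lemma bimap1 (C D E : category) (F : functor (prod_cat C D) E)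
    (A : C) (B : D) : bimap F (idm A) (idm B) = idm _.
Proof. exact: (fmap1 F (A, B)). Qed.

Section PartialActions.
Variables (V : monoidal) (C : action V).

(* For act_on and act_by: an object in place of a morphism is its identity,
   so these are (-) * A and W * (-). *)
Program Definition act_on (A : C) : functor V C :=
  @Functor V C (fun W => W ⊛ A) (fun _ _ w => w ⊛₁ idm A) _ _.
Next Obligation. by move=> A W /=; rewrite bimap1. Qed.
Next Obligation. by move=> A *; rewrite /= -bimapM comp1m. Qed.

Program Definition act_by (W : V) : functor C C :=
  @Functor C C (fun A => W ⊛ A) (fun _ _ f => idm W ⊛₁ f) _ _.
Next Obligation. by move=> W A /=; rewrite bimap1. Qed.
Next Obligation. by move=> W *; rewrite /= -bimapM comp1m. Qed.

End PartialActions.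

(* enrich A B is the hom-object of maps A -> B in V, and cotens W B is the
   object written [W, B]; both are functorial in B via the adjunctions. *)
Record biclosed_action (V : monoidal) := BiclosedAction {
  bact :> action V;
  enrich : forall A : bact, right_adjoint (act_on A);
  cotens : forall W : V, right_adjoint (act_by bact W)
}.
Arguments enrich {V} _ A.
Arguments cotens {V} _ W.

Section Strong.
Variables (V : monoidal) (C : action V).

Record strong_functor := StrongFunctor {
  sfun :> functor C C;
  strength : forall (W : V) (A : C), hom (W ⊛ sfun A) (sfun (W ⊛ A));
  strength_nat : forall (W W' : V) (A A' : C) (w : hom W W') (f : hom A A'),
    strength W' A' ∘ (w ⊛₁ fmap sfun f) = fmap sfun (w ⊛₁ f) ∘ strength W A;
  strength_unit : forall A : C,
    fmap sfun (aunit A) ∘ strength munit A = aunit (sfun A);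
  strength_assoc : forall (U W : V) (A : C),
    strength U (W ⊛ A) ∘ (idm U ⊛₁ strength W A) ∘ aassoc U W (sfun A)
    = fmap sfun (aassoc U W A) ∘ strength (U ⊗ W) A
}.

Program Definition id_strong : strong_functor :=
  @StrongFunctor (id_functor C) (fun W A => idm (W ⊛ A)) _ _ _.
Next Obligation. by move=> * /=; rewrite compm1 comp1m. Qed.
Next Obligation. by move=> * /=; rewrite compm1. Qed.
Next Obligation. by move=> * /=; rewrite bimap1 !comp1m compm1. Qed.

Program Definition comp_strong (G F : strong_functor) : strong_functor :=
  @StrongFunctor (comp_functor G F)
    (fun W A => fmap G (strength F W A) ∘ strength G W (F A)) _ _ _.
Next Obligation.
move=> G F W W' A A' w f /=.
by rewrite -compmA strength_nat !compmA -!fmapM strength_nat.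
Qed.
Next Obligation.
by move=> G F A /=; rewrite compmA -fmapM !strength_unit.
Qed.
Next Obligation.
move=> G F U W A /=.
rewrite -[idm U](comp1m (idm U)) bimapM !compmA.
rewrite -(compmA _ (strength G U (F (W ⊛ A)))) strength_nat !compmA.
rewrite -!fmapM -!compmA [strength G _ _ ∘ _]compmA strength_assoc !compmA.
by rewrite -!fmapM strength_assoc.
Qed.

Definition strong_functor_morphism (F G : strong_functor)
    (tau : forall A, hom (F A) (G A)) : Prop :=
  (forall (A B : C) (f : hom A B), tau B ∘ fmap F f = fmap G f ∘ tau A) /\
  (forall (W : V) (A : C),
     strength G W A ∘ (idm W ⊛₁ tau A) = tau (W ⊛ A) ∘ strength F W A).

Record strong_monad := StrongMonad {
  smon :> strong_functor;
  eta : forall A, hom A (smon A);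
  mu : forall A, hom (smon (smon A)) (smon A);
  eta_strong : strong_functor_morphism (F := id_strong) eta;
  mu_strong : strong_functor_morphism (F := comp_strong smon smon) mu;
  mu_etal : forall A, mu A ∘ eta (smon A) = idm (smon A);
  mu_etar : forall A, mu A ∘ fmap smon (eta A) = idm (smon A);
  muA : forall A, mu A ∘ mu (smon A) = mu A ∘ fmap smon (mu A)
}.

Definition monad_morphism (S T : strong_monad)
    (tau : forall A, hom (S A) (T A)) : Prop :=
  (forall A, tau A ∘ eta S A = eta T A) /\
  (forall A, tau A ∘ mu S A = mu T A ∘ (fmap T (tau A) ∘ tau (S A))).

Definition strong_monad_morphism (S T : strong_monad)
    (tau : forall A, hom (S A) (T A)) : Prop :=
  strong_functor_morphism tau /\ monad_morphism tau.

Definition em_algebra (T : strong_monad) (X : C) (s : hom (T X) X) : Prop :=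
  s ∘ eta T X = idm X /\ s ∘ mu T X = s ∘ fmap T s.

End Strong.

Section Clone.
Variables (V : monoidal) (C : biclosed_action V).

(* Contravariant actions of the bifunctors enrich and cotens, i.e. the unique
   ones making the counits dinatural. *)
Definition ihom_precomp (A B X : C) (f : hom A B) :
    hom (enrich C B X) (enrich C A X) :=
  transpose (enrich C A) (counit (enrich C B) X ∘ (idm (enrich C B X) ⊛₁ f)).

Definition cotens_precomp (U W : V) (X : C) (u : hom U W) :
    hom (cotens C W X) (cotens C U X) :=
  transpose (cotens C U) (counit (cotens C W) X ∘ (u ⊛₁ idm (cotens C W X))).

Variable X : C.

Definition clone_obj (A : C) : C := cotens C (enrich C A X) X.

Definition clone_map (A B : C) (f : hom A B) :
    hom (clone_obj A) (clone_obj B) :=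
  cotens_precomp X (ihom_precomp X f).

Definition sigma (F : strong_functor C) (f : hom (F X) X) (A : C) :
    hom (F A) (clone_obj A) :=
  transpose (cotens C (enrich C A X))
    (f ∘ fmap F (counit (enrich C A) X) ∘ strength F (enrich C A X) A).

Definition ihom_act (W : V) (A : C) :
    hom (enrich C (W ⊛ A) X ⊗ W) (enrich C A X) :=
  transpose (enrich C A)
    (counit (enrich C (W ⊛ A)) X ∘ aassoc (enrich C (W ⊛ A) X) W A).

Definition clone_strength (W : V) (A : C) :
    hom (W ⊛ clone_obj A) (clone_obj (W ⊛ A)) :=
  transpose (cotens C (enrich C (W ⊛ A) X))
    (counit (cotens C (enrich C A X)) X ∘ (ihom_act W A ⊛₁ idm (clone_obj A))
       ∘ bwd (aassoc (enrich C (W ⊛ A) X) W (clone_obj A))).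

Definition ihom_unit : hom munit (enrich C X X) :=
  transpose (enrich C X) (aunit X).

Definition clone_nu : hom (clone_obj X) X :=
  counit (cotens C munit) X ∘ bwd (aunit (cotens C munit X))
    ∘ cotens_precomp X ihom_unit.

(* A "generalised operation" p : W * A -> X evaluates W * C_X A in X.
   These evaluations are jointly monic (clone_ext), and the structure of the
   clone monad is characterised by its effect on them. *)
Definition clone_ev (W : V) (A : C) (p : hom (W ⊛ A) X) :
    hom (W ⊛ clone_obj A) X :=
  counit (cotens C (enrich C A X)) X
    ∘ (transpose (enrich C A) p ⊛₁ idm (clone_obj A)).

Lemma transpose_precomp (W W' : V) (A : C) (w : hom W W') (p : hom (W' ⊛ A) X) :
  transpose (enrich C A) p ∘ w
  = transpose (enrich C A) (p ∘ (w ⊛₁ idm A) : hom (act_on A W) X).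
Proof.
rewrite -[LHS](transpose_uniq (enrich C A)); congr transpose.
by rewrite fmapM compmA transposeK.
Qed.

Lemma actS (W W' : V) (A A' : C) (w : hom W W') (f : hom A A') :
  (w ⊛₁ idm A') ∘ (idm W ⊛₁ f) = (idm W' ⊛₁ f) ∘ (w ⊛₁ idm A).
Proof. by rewrite -!bimapM !comp1m !compm1. Qed.

Lemma act_byM (W : V) (A B D : C) (g : hom B D) (f : hom A B) :
  idm W ⊛₁ (g ∘ f) = (idm W ⊛₁ g) ∘ (idm W ⊛₁ f).
Proof. by rewrite -bimapM comp1m. Qed.

Lemma cotens_transposeK (W : V) (Y : C) (f : hom (W ⊛ Y) X) :
  counit (cotens C W) X ∘ (idm W ⊛₁ transpose (cotens C W) f) = f.
Proof. exact: (transposeK (cotens C W) f). Qed.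

Lemma clone_ev_transpose (W : V) (A Y : C) (p : hom (W ⊛ A) X)
    (f : hom (enrich C A X ⊛ Y) X) :
  clone_ev p ∘ (idm W ⊛₁ transpose (cotens C (enrich C A X)) f)
  = f ∘ (transpose (enrich C A) p ⊛₁ idm Y).
Proof. by rewrite /clone_ev -compmA actS compmA cotens_transposeK. Qed.

Lemma clone_ext (A Y : C) (g h : hom Y (clone_obj A)) :
  (forall (W : V) (p : hom (W ⊛ A) X),
     clone_ev p ∘ (idm W ⊛₁ g) = clone_ev p ∘ (idm W ⊛₁ h)) ->
  g = h.
Proof.
move=> /(_ (enrich C A X) (counit (enrich C A) X)).
rewrite /clone_ev.
have -> : transpose (enrich C A) (counit (enrich C A) X) = idm (enrich C A X).
  rewrite -[RHS](transpose_uniq (enrich C A)).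
  by rewrite fmap1 compm1.
rewrite bimap1 compm1 => e.
rewrite -[g](transpose_uniq (cotens C (enrich C A X))).
rewrite -[h](transpose_uniq (cotens C (enrich C A X))).
by congr transpose.
Qed.

Lemma clone_ev_act (W W' : V) (A : C) (w : hom W W') (p : hom (W' ⊛ A) X) :
  clone_ev p ∘ (w ⊛₁ idm (clone_obj A)) = clone_ev (p ∘ (w ⊛₁ idm A)).
Proof.
by rewrite /clone_ev -compmA -bimapM compm1 transpose_precomp.
Qed.

Lemma clone_ev_map (W : V) (A B : C) (f : hom A B) (p : hom (W ⊛ B) X) :
  clone_ev p ∘ (idm W ⊛₁ clone_map f) = clone_ev (p ∘ (idm W ⊛₁ f)).
Proof.
rewrite clone_ev_transpose -compmA -bimapM compm1 /clone_ev.
congr (_ ∘ (_ ⊛₁ _)); rewrite transpose_precomp; congr transpose.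
by rewrite -compmA -actS compmA (transposeK (enrich C B)).
Qed.

Lemma aassocV (U U' W W' : V) (A B : C) (u : hom U U') (w : hom W W')
    (f : hom A B) :
  bwd (aassoc U' W' B) ∘ (u ⊛₁ (w ⊛₁ f))
  = ((u ⊗₁ w) ⊛₁ f) ∘ bwd (aassoc U W A).
Proof.
rewrite -[LHS]compm1 -(bwdK (aassoc U W A)) !compmA; congr (_ ∘ _).
by rewrite -compmA -aassoc_nat compmA fwdK comp1m.
Qed.

Lemma apentagonV (U W Z : V) (A : C) :
  (massoc U W Z ⊛₁ idm A) ∘ bwd (aassoc (U ⊗ W) Z A)
    ∘ bwd (aassoc U W (Z ⊛ A)) ∘ (idm U ⊛₁ aassoc W Z A)
  = bwd (aassoc U (W ⊗ Z) A).
Proof.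
rewrite -[LHS]comp1m -(fwdK (aassoc U (W ⊗ Z) A)) -!compmA.
rewrite -[RHS]compm1; congr (_ ∘ _).
have e : aassoc U (W ⊗ Z) A ∘ (massoc U W Z ⊛₁ idm A)
    = (idm U ⊛₁ bwd (aassoc W Z A)) ∘ aassoc U W (Z ⊛ A) ∘ aassoc (U ⊗ W) Z A.
  by rewrite -compmA -apentagon !compmA -act_byM fwdK bimap1 comp1m.
rewrite compmA e -!compmA (compmA (fwd (aassoc (U ⊗ W) Z A))) bwdK comp1m.
rewrite (compmA (fwd (aassoc U W (Z ⊛ A)))) bwdK comp1m.
by rewrite -act_byM fwdK bimap1.
Qed.

Lemma aunitV (A B : C) (f : hom A B) :
  bwd (aunit B) ∘ f = (idm munit ⊛₁ f) ∘ bwd (aunit A).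
Proof.
rewrite -[LHS]compm1 -(bwdK (aunit A)) !compmA; congr (_ ∘ _).
by rewrite -compmA -aunit_nat compmA fwdK comp1m.
Qed.

Lemma clone_ev_strength (U W : V) (A : C) (p : hom (U ⊛ (W ⊛ A)) X) :
  clone_ev p ∘ (idm U ⊛₁ clone_strength W A)
  = clone_ev (p ∘ aassoc U W A) ∘ bwd (aassoc U W (clone_obj A)).
Proof.
rewrite clone_ev_transpose -compmA -(bimap1 (act C)) aassocV !compmA.
congr (_ ∘ _); rewrite -compmA -bimapM compm1 /clone_ev.
congr (_ ∘ (_ ⊛₁ _)); rewrite transpose_precomp; congr transpose.
rewrite -compmA aassoc_nat bimap1 compmA.
by rewrite (transposeK (enrich C (W ⊛ A))).
Qed.

Lemma clone_nuE : clone_nu = clone_ev (aunit X) ∘ bwd (aunit (clone_obj X)).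
Proof.
by rewrite /clone_nu -compmA aunitV compmA cotens_transposeK.
Qed.

Lemma clone_ev_sigma (F : strong_functor C) (f : hom (F X) X)
    (W : V) (A : C) (p : hom (W ⊛ A) X) :
  clone_ev p ∘ (idm W ⊛₁ sigma f A) = f ∘ fmap F p ∘ strength F W A.
Proof.
rewrite clone_ev_transpose -compmA -(fmap1 F) strength_nat compmA.
congr (_ ∘ _); rewrite -compmA -fmapM; congr (_ ∘ fmap _ _).
exact: (transposeK (enrich C A)).
Qed.

Program Definition clone_functor : functor C C :=
  @Functor C C clone_obj clone_map _ _.
Next Obligation.
move=> A; apply: clone_ext => W p.
by rewrite clone_ev_map !bimap1 !compm1.
Qed.
Next Obligation.
move=> A B D g f; apply: clone_ext => W p.
by rewrite clone_ev_map !act_byM !compmA !clone_ev_map.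
Qed.

Lemma clone_ev_bimap (W W' : V) (A B : C) (w : hom W W') (f : hom A B)
    (p : hom (W' ⊛ B) X) :
  clone_ev p ∘ (w ⊛₁ clone_map f) = clone_ev (p ∘ (w ⊛₁ f)).
Proof.
rewrite -(comp1m w) -(compm1 (clone_map f)) bimapM compmA.
rewrite clone_ev_map clone_ev_act -compmA -bimapM.
by rewrite comp1m compm1.
Qed.

Program Definition clone_strong : strong_functor C :=
  @StrongFunctor V C clone_functor clone_strength _ _ _.
Next Obligation.
move=> W W' A A' w f /=; apply: clone_ext => U p.
rewrite !act_byM !compmA clone_ev_strength clone_ev_map clone_ev_strength.
rewrite -compmA aassocV compmA; congr (_ ∘ _).
by rewrite clone_ev_bimap -!compmA aassoc_nat.
Qed.
Next Obligation.
move=> A /=; apply: clone_ext => U p.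
rewrite act_byM compmA clone_ev_map clone_ev_strength -compmA aunitr.
by rewrite -clone_ev_act -aunitr -!compmA bwdK compm1.
Qed.
Next Obligation.
move=> U W A /=; apply: clone_ext => Z p.
rewrite !act_byM !compmA clone_ev_map !clone_ev_strength.
rewrite -(compmA _ (bwd _)) aassocV bimap1 compmA clone_ev_strength.
rewrite -(compmA p (fwd _) (fwd _)) -apentagon !compmA -clone_ev_act.
by rewrite -!compmA -apentagonV -!compmA.
Qed.

(* Every operation p factors through nu. *)
Lemma clone_ev_nu (W : V) (A : C) (p : hom (W ⊛ A) X) :
  clone_nu ∘ clone_map p ∘ clone_strength W A = clone_ev p.
Proof.
rewrite clone_nuE -!compmA aunitV act_byM !compmA clone_ev_map.
rewrite clone_ev_strength aunit_nat -(compmA p) aunitl -clone_ev_act -aunitl.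
by rewrite -!compmA (compmA (fwd (aassoc _ _ _))) bwdK comp1m bwdK compm1.
Qed.

Lemma clone_ev_mu (W : V) (A : C) (p : hom (W ⊛ A) X) :
  clone_ev p ∘
    (idm W ⊛₁ sigma (F := comp_strong clone_strong clone_strong)
       (clone_nu ∘ fmap clone_strong clone_nu) A)
  = clone_ev (clone_ev p).
Proof.
rewrite clone_ev_sigma /= -[RHS]clone_ev_nu -(clone_ev_nu p).
have mapM := fmapM clone_functor; rewrite /= in mapM.
by rewrite !mapM !compmA.
Qed.

Lemma clone_ev_eta (W : V) (A : C) (p : hom (W ⊛ A) X) :
  clone_ev p ∘ (idm W ⊛₁ sigma (F := id_strong C) (idm X) A) = p.
Proof. by rewrite clone_ev_sigma /= comp1m compm1. Qed.

Program Definition clone_monad : strong_monad C :=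
  @StrongMonad V C clone_strong
    (sigma (F := id_strong C) (idm X))
    (sigma (F := comp_strong clone_strong clone_strong)
       (clone_nu ∘ fmap clone_strong clone_nu)) _ _ _ _ _.
Next Obligation.
split=> [A B f|W A]; apply: clone_ext => U p.
  by rewrite /= !act_byM !compmA clone_ev_map !clone_ev_eta.
rewrite /= compm1 clone_ev_eta act_byM compmA clone_ev_strength.
rewrite -compmA aassocV bimap1 compmA clone_ev_eta.
by rewrite -compmA bwdK compm1.
Qed.
Next Obligation.
split=> [A B f|W A]; apply: clone_ext => U p; rewrite !act_byM !compmA clone_ev_mu.
  by rewrite [fmap _ f]/= !clone_ev_map clone_ev_mu.
rewrite clone_ev_strength -[LHS]compmA aassocV bimap1 compmA clone_ev_mu.
by rewrite clone_ev_map !clone_ev_strength -(compmA _ (bwd _)) fwdK compm1.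
Qed.
Next Obligation.
move=> A; apply: clone_ext => W p.
by rewrite act_byM compmA clone_ev_mu clone_ev_eta bimap1 compm1.
Qed.
Next Obligation.
move=> A; apply: clone_ext => W p.
by rewrite act_byM compmA clone_ev_mu clone_ev_map clone_ev_eta bimap1 compm1.
Qed.
Next Obligation.
move=> A; apply: clone_ext => W p.
by rewrite !act_byM !compmA !clone_ev_mu clone_ev_map clone_ev_mu.
Qed.

End Clone.

(* Main.v *)
Require Import Defs.
From mathcomp Require Import all_boot.
From mathcomp Require Import boolp classical_sets functions.
Local Open Scope classical_set_scope.

(** The inverse of [s |-> sigma s] is [tau |-> nu ∘ tau_X]: a strong natural
transformation into [C_X] is determined by [nu ∘ tau_X], since naturality and
strength let one compute its evaluation at any [p : W * A -> X].  The monad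
laws for [tau] then correspond to the Eilenberg-Moore laws because [nu] is
itself an algebra of the clone monad. *)

Local Open Scope cat_scope.

Section CloneAlgebras.
Variables (V : monoidal) (C : biclosed_action V) (X : C).

(** [clone_nu] is evaluation at the operation [aunit X], where the unit law of the strength leaves
    only [s]. *)
Lemma clone_nu_sigma (F : strong_functor C) (s : hom (F X) X) :
  clone_nu X ∘ sigma s X = s.
Proof.
rewrite clone_nuE -compmA aunitV compmA clone_ev_sigma -!compmA.
by rewrite (compmA (fmap F _)) strength_unit bwdK compm1.
Qed.

(** After evaluation at each [p], naturality of [sigma s] reduces to naturality of the strength of
    [F], and compatibility with strengths to [strength_assoc]. *)
Lemma sigma_strong (F : strong_functor C) (s : hom (F X) X) :
  strong_functor_morphism (G := clone_strong X) (sigma s).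
Proof.
split=> [A B f|W A]; apply: clone_ext => U p; rewrite !act_byM !compmA.
  rewrite clone_ev_sigma [fmap (clone_strong X) f]/= clone_ev_map.
  by rewrite clone_ev_sigma -[LHS]compmA strength_nat fmapM !compmA.
rewrite clone_ev_strength -[LHS]compmA aassocV compmA.
rewrite bimap1 !clone_ev_sigma fmapM -!compmA; congr (_ ∘ (_ ∘ _)).
rewrite [LHS]compmA -strength_assoc -!compmA.
by rewrite bwdK compm1.
Qed.

Lemma sigma_clone_nu (F : strong_functor C)
    (tau : forall A, hom (F A) (clone_strong X A)) :
  strong_functor_morphism tau ->
  forall A, sigma (clone_nu X ∘ tau X) A = tau A.
Proof.
case=> tau_nat tau_str A; apply: clone_ext => W p.
(* Moving [tau] past [fmap F p] and the strength leaves [clone_nu X ∘ clone_map p ∘ clone_strength W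
   A] in front, which is [clone_ev p]. *)
rewrite clone_ev_sigma -(compmA (clone_nu X)) tau_nat -!compmA -tau_str.
by rewrite !compmA clone_ev_nu.
Qed.

(** The unit and multiplication of the clone monad are themselves values of [sigma], so both laws
    are instances of [clone_nu_sigma]. *)
Lemma clone_nu_em_algebra : em_algebra (T := clone_monad X) (clone_nu X).
Proof.
split; first exact: (clone_nu_sigma (id_strong C)).
exact: (clone_nu_sigma (comp_strong (clone_strong X) (clone_strong X))).
Qed.

Lemma sigma_monad_morphism (T : strong_monad C) (s : hom (T X) X) :
  em_algebra s -> monad_morphism (T := clone_monad X) (sigma s).
Proof.
case=> s_eta s_mu.
have [eta_nat eta_str] := eta_strong T; have [mu_nat mu_str] := mu_strong T.
split=> A; apply: clone_ext => W p; rewrite !act_byM !compmA.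
  rewrite clone_ev_sigma clone_ev_eta -!compmA eta_str /= compm1.
  by rewrite -eta_nat /= compmA s_eta comp1m.
(* Evaluated at [p], the two sides differ only by [s ∘ mu T X] against [s ∘ fmap T s], once [mu] is
   moved past [p]. *)
rewrite clone_ev_mu clone_ev_map !clone_ev_sigma -[LHS]compmA mu_str /=.
rewrite !fmapM !compmA -s_mu -(compmA s _ (mu T _)) -mu_nat /=.
by rewrite !compmA.
Qed.

(** Algebras pull back along monad morphisms; here the algebra is [clone_nu X]. *)
Lemma clone_nu_pullback (T : strong_monad C)
    (tau : forall A, hom (T A) (clone_monad X A)) :
  strong_monad_morphism tau -> em_algebra (T := T) (clone_nu X ∘ tau X).
Proof.
case=> [[tau_nat _] [tau_eta tau_mu]]; have [nu_eta nu_mu] := clone_nu_em_algebra.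
split; first by rewrite -compmA tau_eta.
rewrite -compmA tau_mu (compmA (clone_nu X)) nu_mu.
by rewrite -[RHS](compmA _ (tau X)) tau_nat fmapM !compmA.
Qed.

End CloneAlgebras.

Local Close Scope cat_scope.

Theorem theorem3p7 (V : monoidal) (C : biclosed_action V) (X : C) :
  (forall T : strong_functor C,
     set_bij [set: hom (T X) X]
             [set tau : forall A : C, hom (T A) (clone_strong X A) |
                strong_functor_morphism tau]
             (fun s => sigma s)) /\
  (forall T : strong_monad C,
     set_bij [set s : hom (T X) X | em_algebra s]
             [set tau : forall A : C, hom (T A) (clone_monad X A) |
                strong_monad_morphism tau]
             (fun s => sigma s)).
Proof.
have sigma_inj (F : strong_functor C) (s t : hom (F X) X) :
    sigma s = sigma t -> s = t.
  by move=> st; rewrite -[s]clone_nu_sigma st clone_nu_sigma.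
split=> T; split.
- by move=> s _; apply: sigma_strong.
- by move=> s t _ _; apply: sigma_inj.
- move=> tau tauP; exists (clone_nu X ∘ tau X)%cat => //.
  by apply/functional_extensionality_dep; apply: sigma_clone_nu.
- by move=> s sP; split; [apply: sigma_strong|apply: sigma_monad_morphism].
- by move=> s t _ _; apply: sigma_inj.
- move=> tau tauP; exists (clone_nu X ∘ tau X)%cat.
    exact: clone_nu_pullback.
  (* The preimage is the same as in the first part, so only the strong functor half of [tauP] enters
     here. *)
  by apply/functional_extensionality_dep; apply: sigma_clone_nu; case: tauP.
Qed.
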